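(* Let $\{x^k\},\{d^k\}$ be infinite sequences generated by the MMG scheme described in the context, with arbitrary stepsizes $\alpha_k>0$ and with $v(x^k)\neq 0$ for all $k\ge 0$. Suppose that there is a constant $\gamma^*>0$ such that $\gamma_k\ge\gamma^*$ for all $k\ge0$, and that for all $k\ge 1$ and $j\in\{1,\dots,N_k\}$, $$\beta_{kj}=-\frac{1}{N_k}\,\psi(x^k,v(x^k))\,\phi_{kj}^{+},\qquad \phi_{kj}>\frac{\psi(x^k,d^{k-j})+\|JF(x^k)\|\,\|d^{k-j}\|}{\gamma_k}.$$ Then, with $\sigma=\gamma^*/2>0$, the sufficient descent condition $$\psi(x^k,d^k)\le\sigma\,\psi(x^k,v(x^k))$$ holds for every $k\ge 0$.
   Context: Let $F=(F_1,\dots,F_m)^\top:\mathbb{R}^n\to\mathbb{R}^m$ with every $F_i$ continuously differentiable, and let $JF(x)\in\mathbb{R}^{m\times n}$ be its Jacobian, with rows $\nabla F_i(x)^\top$. Vectors carry the Euclidean norm; a matrix $A\in\mathbb{R}^{m\times n}$ carries the norm $\|A\|=\max_{1\le i\le m}\|A_{i,\cdot}\|$ (maximum Euclidean norm of the rows). Define $\psi(x,d)=\max_{1\le i\le m}\langle\nabla F_i(x),d\rangle$ and let $v(x)$ be the unique minimizer over $d\in\mathbb{R}^n$ of $\psi(x,d)+\frac12\|d\|^2$. (A point $x$ is Pareto critical iff $\psi(x,d)\ge0$ for all $d$, iff $v(x)=0$.) For $\chi\in\mathbb{R}$ put $\chi^+=0$ if $\chi=0$ and $\chi^+=1/\chi$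 otherwise. MMG scheme: given $x^0\in\mathbb{R}^n$, a positive integer $N$, parameters $\gamma_k>0$ ($k\ge0$) and $\beta_{kj}\in\mathbb{R}$ ($k\ge1$, $1\le j\le N_k$, where $N_k=\min\{k,N\}$), set $d^0=\gamma_0v(x^0)$, $d^k=\gamma_kv(x^k)+\sum_{j=1}^{N_k}\beta_{kj}d^{k-j}$ for $k\ge1$, and $x^{k+1}=x^k+\alpha_kd^k$ with $\alpha_k>0$. The $\phi_{kj}$ are real parameters. *)

(* Defs.v *)
From HB Require Import structures.
From mathcomp Require Import all_boot all_order all_algebra.
From mathcomp Require Import all_classical all_reals all_analysis.

Set Implicit Arguments.
Unset Strict Implicit.
Unset Printing Implicit Defensive.

Import Order.TTheory GRing.Theory Num.Theory.
Import numFieldNormedType.Exports.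

Local Open Scope classical_set_scope.
Local Open Scope ring_scope.

(* Vectors of R^n are row vectors 'rV[R]_n.  The norm `|u| that the library
   puts on matrices is the sup norm, so the Euclidean norm is defined here;
   only the topology (hence differentiability and continuity) is taken from
   the library.  The number of objectives is written m.+1, since a maximum
   over the objectives is taken. *)

Definition dot (R : realType) (n : nat) (u w : 'rV[R]_n) : R :=
  \sum_(j < n) u 0 j * w 0 j.

Definition enorm (R : realType) (n : nat) (u : 'rV[R]_n) : R :=
  Num.sqrt (dot u u).

(* Seeding the iterated max with the value at index 0 does not alter it. *)
Definition maxI (R : realType) (m : nat) (a : 'I_m.+1 -> R) : R :=
  \big[Num.max/a ord0]_(i < m.+1) a i.

Definition rownorm (R : realType) (m n : nat) (A : 'M[R]_(m.+1, n)) : R :=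
  maxI (fun i => enorm (row i A)).

(* The library's jacobian acts on row vectors from the right (its columns are
   the gradients of the components); transposing gives the usual matrix. *)
Definition JF (R : realType) (n m : nat) (F : 'rV[R]_n -> 'rV[R]_m)
    (x : 'rV[R]_n) : 'M[R]_(m, n) :=
  (jacobian F x)^T.

Definition gradF (R : realType) (n m : nat) (F : 'rV[R]_n -> 'rV[R]_m)
    (i : 'I_m) (x : 'rV[R]_n) : 'rV[R]_n :=
  row i (JF F x).

Definition cont_diff (R : realType) (n m : nat)
    (F : 'rV[R]_n -> 'rV[R]_m) : Prop :=
  forall i : 'I_m,
    (forall x, differentiable (fun y : 'rV[R]_n => F y 0 i) x) /\
    continuous (gradF F i).

Definition psi (R : realType) (n m : nat) (F : 'rV[R]_n -> 'rV[R]_m.+1)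
    (x d : 'rV[R]_n) : R :=
  maxI (fun i => dot (gradF F i x) d).

Definition is_dir_minimizer (R : realType) (n m : nat)
    (F : 'rV[R]_n -> 'rV[R]_m.+1) (x d : 'rV[R]_n) : Prop :=
  forall d' : 'rV[R]_n,
    psi F x d + 2^-1 * enorm d ^+ 2 <= psi F x d' + 2^-1 * enorm d' ^+ 2.

(* The objective is continuous, strongly convex and coercive in d, so its
   minimizer exists and is unique: the default value 0 of xget is not used. *)
Definition vdir (R : realType) (n m : nat) (F : 'rV[R]_n -> 'rV[R]_m.+1)
    (x : 'rV[R]_n) : 'rV[R]_n :=
  xget 0 [set d | is_dir_minimizer F x d].

Definition plusinv (R : realType) (chi : R) : R :=
  if chi == 0 then 0 else chi^-1.

Record is_MMG (R : realType) (n m : nat) (F : 'rV[R]_n -> 'rV[R]_m.+1)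
    (N : nat) (gamma : nat -> R) (beta : nat -> nat -> R) (alpha : nat -> R)
    (x d : nat -> 'rV[R]_n) : Prop := IsMMG {
  MMG_memory : (0 < N)%N;
  MMG_gamma : forall k, 0 < gamma k;
  MMG_alpha : forall k, 0 < alpha k;
  MMG_dir0 : d 0%N = gamma 0%N *: vdir F (x 0%N);
  MMG_dir : forall k, (1 <= k)%N ->
    d k = gamma k *: vdir F (x k)
          + \sum_(1 <= j < (minn k N).+1) beta k j *: d (k - j)%N;
  MMG_step : forall k, x k.+1 = x k + alpha k *: d k
}.

(* Agreement with partial derivatives. *)
Lemma JFE (R : realType) (n m : nat) (F : 'rV[R]_n -> 'rV[R]_m)
    (x : 'rV[R]_n) (i : 'I_m) (j : 'I_n) :
  differentiable F x ->
  JF F x i j = ('D_(delta_mx 0 j) F x) 0 i.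
Proof.
by move=> dF; rewrite deriveEjacobian// -rowE /JF [LHS]mxE [RHS]mxE.
Qed.

(* Main.v *)
Require Import Defs.
From HB Require Import structures.
From mathcomp Require Import all_boot all_order all_algebra.
From mathcomp Require Import all_classical all_reals all_analysis.
From mathcomp Require Import ring lra.

Import Order.TTheory GRing.Theory Num.Theory.
Import numFieldNormedType.Exports.

Local Open Scope ring_scope.

(** Write [v = vdir F (x k)] and [N_k = minn k N].  The function [psi F y] is a
    maximum of linear forms, hence sublinear, so the recursion for [d k] gives
    [psi (d k) <= gamma_k psi v + \sum_j beta_kj psi (d (k - j))] as soon as
    the [beta_kj] are nonnegative.  Two facts finish the argument.

    First, [psi v < 0]: the nonzero [v] does at least as well as the direction
    [0] in the direction subproblem, whose value at [0] is [0]
    ([psi_vdir_lt0]).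

    Second, by Cauchy-Schwarz [|psi d| <= ||JF|| ||d||] ([normr_psi_le]).  So
    the lower bound imposed on [phi_kj] is nonnegative, which makes [phi_kj]
    and then [beta_kj] positive, and it is at least [2 psi (d (k - j)) /
    gamma_k], which gives [psi (d (k - j)) / phi_kj <= gamma_k / 2].  Each of
    the [N_k] momentum terms therefore contributes at most
    [- psi v (gamma_k / 2) / N_k]: together they cancel at most half of the
    decrease [gamma_k psi v], and [gamma_k >= gamma_star] concludes. *)

Section EuclideanDot.
Context {R : realType} {n : nat}.
Implicit Types u v w : 'rV[R]_n.

Lemma dotDr u v w : dot u (v + w) = dot u v + dot u w.
Proof. by rewrite -big_split; apply: eq_bigr => j _; rewrite mxE mulrDr. Qed.

Lemma dotZr a u w : dot u (a *: w) = a * dot u w.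
Proof. by rewrite mulr_sumr; apply: eq_bigr => j _; rewrite mxE mulrCA. Qed.

Lemma dotC u w : dot u w = dot w u.
Proof. by apply: eq_bigr => j _; rewrite mulrC. Qed.

Lemma dot0r u : dot u 0 = 0.
Proof. by rewrite -(scale0r 0) dotZr mul0r. Qed.

Lemma dot_ge0 u : 0 <= dot u u.
Proof. by apply: sumr_ge0 => j _; rewrite -expr2 sqr_ge0. Qed.

Lemma dot_eq0 u : (dot u u == 0) = (u == 0).
Proof.
apply/idP/eqP => [|->]; last by rewrite dot0r.
rewrite psumr_eq0 => [/allP u0|j _]; last by rewrite -expr2 sqr_ge0.
apply/rowP => j; rewrite mxE; apply/eqP.
by have := u0 j (mem_index_enum j); rewrite -expr2 sqrf_eq0.
Qed.

Lemma sqr_enorm u : enorm u ^+ 2 = dot u u.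
Proof. by rewrite sqr_sqrtr // dot_ge0. Qed.

Lemma enorm_gt0 u : (0 < enorm u) = (u != 0).
Proof. by rewrite sqrtr_gt0 lt_neqAle dot_ge0 andbT eq_sym dot_eq0. Qed.

(** Cauchy-Schwarz: the squared norm of [dot w w *: u - dot u w *: w] equals
    [dot w w * (dot u u * dot w w - dot u w ^+ 2)]. *)
Lemma normr_dot_le u w : `|dot u w| <= enorm u * enorm w.
Proof.
have [->|w_neq0] := eqVneq w 0.
  by rewrite dot0r normr0 mulr_ge0 // sqrtr_ge0.
rewrite -(ler_pXn2r (ltn0Sn 1)) ?nnegrE ?mulr_ge0 ?sqrtr_ge0 //.
rewrite real_normK ?num_real // exprMn !sqr_enorm -subr_ge0.
have ww_gt0 : 0 < dot w w by rewrite lt_neqAle dot_ge0 andbT eq_sym dot_eq0.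
rewrite -(pmulr_rge0 _ ww_gt0).
have := dot_ge0 (dot w w *: u + (- dot u w) *: w).
rewrite dotDr !dotZr !(dotC (_ + _)) !dotDr !dotZr (dotC w u).
by congr (0 <= _); ring.
Qed.

End EuclideanDot.

Section FiniteMax.
Context {R : realType} {m : nat}.
Implicit Type a : 'I_m.+1 -> R.

Lemma le_maxI a i : a i <= maxI a.
Proof. exact: le_bigmax. Qed.

Lemma maxI_le a c : (forall i, a i <= c) -> maxI a <= c.
Proof. by move=> a_le; apply: bigmax_le. Qed.

End FiniteMax.

Section DirectionalMax.
Context {R : realType} {n m : nat} (F : 'rV[R]_n -> 'rV[R]_m.+1).
Implicit Types y u w : 'rV[R]_n.

Lemma psi0 y : psi F y 0 = 0.
Proof.
apply/le_anti/andP; split; first by apply: maxI_le => i; rewrite dot0r.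
by have := le_maxI (fun i => dot (gradF F i y) 0) ord0; rewrite /= dot0r.
Qed.

Lemma psiD_le y u w : psi F y (u + w) <= psi F y u + psi F y w.
Proof.
apply: maxI_le => i; rewrite dotDr.
by apply: lerD; [apply: (le_maxI (fun i => dot _ u))
                |apply: (le_maxI (fun i => dot _ w))].
Qed.

Lemma psiZ_le y a u : 0 <= a -> psi F y (a *: u) <= a * psi F y u.
Proof.
move=> a_ge0; apply: maxI_le => i; rewrite dotZr ler_wpM2l //.
exact: (le_maxI (fun i => dot _ u)).
Qed.

Lemma psi_sum_le (I : Type) (r : seq I) (P : pred I) (w : I -> 'rV[R]_n) y :
  psi F y (\sum_(i <- r | P i) w i) <= \sum_(i <- r | P i) psi F y (w i).
Proof.
elim/big_rec2: _ => [|i s u _ IH]; first by rewrite psi0.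
by apply: le_trans (psiD_le _ _ _) _; rewrite lerD2l.
Qed.

Lemma normr_psi_le y u : `|psi F y u| <= rownorm (JF F y) * enorm u.
Proof.
have grad_le i : `|dot (gradF F i y) u| <= rownorm (JF F y) * enorm u.
  apply: le_trans (normr_dot_le _ _) _; rewrite ler_wpM2r ?sqrtr_ge0 //.
  exact: (le_maxI (fun i => enorm (row i (JF F y)))).
rewrite ler_norml; apply/andP; split.
  have := grad_le ord0; rewrite ler_norml => /andP[/le_trans + _]; apply.
  exact: (le_maxI (fun i => dot (gradF F i y) u)).
by apply: maxI_le => i; apply: le_trans (ler_norm _) (grad_le i).
Qed.

(** Since [vdir] returns [0] when the subproblem has no minimizer, a nonzero
    value is a genuine minimizer; comparing it with the direction [0] yields
    [psi v <= - enorm v ^+ 2 / 2]. *)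
Lemma psi_vdir_lt0 y : vdir F y != 0 -> psi F y (vdir F y) < 0.
Proof.
move=> v_neq0; have v_min : is_dir_minimizer F y (vdir F y).
  by move: v_neq0; rewrite /vdir; case: xgetP => //; rewrite eqxx.
have := v_min 0; rewrite psi0 [enorm 0 ^+ 2]sqr_enorm dot0r.
have : 0 < enorm (vdir F y) ^+ 2 by rewrite exprn_gt0 // enorm_gt0.
by lra.
Qed.

End DirectionalMax.

(** The scalar core of the estimate, with [p = psi d] and
    [q = ||JF|| ||d||]: since [p + q] bounds both [0] and [2 p] from above, the
    weight [plusinv f] is nonnegative and tames [p]. *)
Lemma plusinv_bounds (R : realType) (p q g f : R) :
  0 < g -> `|p| <= q -> (p + q) / g < f ->
  0 <= plusinv f /\ plusinv f * p <= g / 2.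
Proof.
move=> g_gt0; rewrite ler_norml ltr_pdivrMr // => /andP[p_ge p_le] f_gt.
have f_gt0 : 0 < f by rewrite -(pmulr_lgt0 _ g_gt0); lra.
rewrite /plusinv gt_eqF // invr_ge0 ltW //; split=> //.
by rewrite mulrC ler_pdivrMr //; lra.
Qed.

Theorem lemma3p2 (R : realType) (n m : nat) (F : 'rV[R]_n -> 'rV[R]_m.+1)
    (N : nat) (gamma : nat -> R) (beta phi : nat -> nat -> R)
    (alpha : nat -> R) (x d : nat -> 'rV[R]_n) (gamma_star : R)
    (F_C1 : cont_diff F)
    (xd_MMG : is_MMG F N gamma beta alpha x d)
    (v_neq0 : forall k : nat, vdir F (x k) != 0)
    (gamma_star_gt0 : 0 < gamma_star)
    (gamma_ge : forall k : nat, gamma_star <= gamma k)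
    (betaE : forall k j : nat, (1 <= k)%N -> (1 <= j <= minn k N)%N ->
      beta k j = - ((minn k N)%:R^-1) * psi F (x k) (vdir F (x k))
                 * plusinv (phi k j))
    (phi_gt : forall k j : nat, (1 <= k)%N -> (1 <= j <= minn k N)%N ->
      (psi F (x k) (d (k - j)%N)
       + rownorm (JF F (x k)) * enorm (d (k - j)%N)) / gamma k < phi k j) :
  let sigma := gamma_star / 2 in
  0 < sigma /\
  forall k : nat, psi F (x k) (d k) <= sigma * psi F (x k) (vdir F (x k)).
Proof.
move=> sigma; split=> [|k]; first by rewrite divr_gt0.
have [N_gt0 gamma_gt0 _ d0E dE _] := xd_MMG.
set psiv := psi F (x k) (vdir F (x k)).
have psiv_lt0 : psiv < 0 by apply: psi_vdir_lt0.
(* It suffices to keep half of the decrease gamma k * psiv. *)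
suff half : psi F (x k) (d k) <= gamma k / 2 * psiv.
  by apply: le_trans half _; rewrite (ler_wnM2r (ltW psiv_lt0)) // /sigma
    ler_pM2r ?invr_gt0.
have gamma_v : psi F (x k) (gamma k *: vdir F (x k)) <= gamma k * psiv.
  by apply: psiZ_le; rewrite ltW.
have [k0|k_gt0] := posnP k.
  have -> : d k = gamma k *: vdir F (x k) by rewrite k0.
  apply: le_trans gamma_v _; rewrite (ler_wnM2r (ltW psiv_lt0)) //.
  by have := gamma_gt0 k; lra.
rewrite dE //; apply: le_trans (psiD_le _ _ _ _) _.
set Nk := minn k N.
have Nk_gt0 : 0 < Nk%:R :> R by rewrite ltr0n leq_min k_gt0.
have momentum j : (1 <= j < Nk.+1)%N ->
    psi F (x k) (beta k j *: d (k - j)%N) <= - psiv * (gamma k / 2) / Nk%:R.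
  move=> jP; have [phi_ge0 phi_le] :=
    plusinv_bounds _ _ _ _ _ (gamma_gt0 k) (normr_psi_le _ _ _)
      (phi_gt k j k_gt0 jP).
  have w_ge0 : 0 <= - psiv / Nk%:R by apply: divr_ge0; rewrite ?oppr_ge0 ltW.
  have {}betaE : beta k j = - psiv / Nk%:R * plusinv (phi k j).
    by rewrite betaE // -/psiv -/Nk; ring.
  apply: le_trans (psiZ_le _ _ _ _ _) _; first by rewrite betaE mulr_ge0.
  by rewrite betaE -[leLHS]mulrA [leRHS]mulrAC ler_wpM2l.
have sum_le : psi F (x k) (\sum_(1 <= j < Nk.+1) beta k j *: d (k - j)%N)
    <= - psiv * (gamma k / 2).
  apply: le_trans (psi_sum_le _ _ _ _ _ _) _.
  apply: le_trans (ler_sum_nat momentum) _.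
  by rewrite sumr_const_nat subn1 /= -[leLHS]mulr_natr divfK ?gt_eqF.
by apply: le_trans (lerD gamma_v sum_le) _; lra.
Qed.
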